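(* Let $I\subset\mathbb{R}$ be an interval, let $a,b\in I$ with $a<b$, and let $f:I\to\mathbb{R}$ be differentiable on the interior $I^{\circ}$ of $I$ and at every point of $[a,b]$ (one-sided derivatives being used at a point of $[a,b]$ that is an endpoint of $I$), with $f'\in L[a,b]$. Let $c>0$ and suppose that $|f'|$ is strongly convex on $[a,b]$ with modulus $c$ and that $|f'(u)|\le M$ for all $u\in[a,b]$. Let $x\in[a,b]$ be such that $M\ge \max\left\{\frac{c(x-a)^2}{6},\frac{c(b-x)^2}{6}\right\}$. Then $$\left| f(x)-\frac{1}{b-a}\int_a^b f(u)\,du\right| \le \frac{(x-a)^2}{2(b-a)}\left(M-\frac{c(x-a)^2}{6}\right)+\frac{(b-x)^2}{2(b-a)}\left(M-\frac{c(b-x)^2}{6}\right).$$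
   Context: A function $h:J\to\mathbb{R}$ on an interval $J$ is called strongly convex with modulus $c>0$ if $h(tx+(1-t)y)\le t h(x)+(1-t)h(y)-ct(1-t)(x-y)^2$ for all $x,y\in J$ and $t\in(0,1)$. $L[a,b]$ denotes the space of Lebesgue integrable functions on $[a,b]$. *)

(* Defs.v *)
From HB Require Import structures.
From mathcomp Require Import all_boot all_order all_algebra.
From mathcomp Require Import all_classical all_reals all_analysis.

#[export] Set Implicit Arguments.
#[export] Unset Strict Implicit.
#[export] Unset Printing Implicit Defensive.

Import Order.TTheory GRing.Theory Num.Theory.
Import numFieldNormedType.Exports.

Local Open Scope classical_set_scope.
Local Open Scope ring_scope.

(* A function on I is a total function [f : R -> R] of which only the values on
   I are used.  The difference quotients of f at x, as h -> 0 with h <> 0 and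
   x + h in I: their limit is the derivative at a point of the interior of I,
   and the one-sided derivative at a point of I that is an endpoint of I. *)
Definition diff_quotient (R : realType) (I : set R) (f : R -> R) (x : R) :=
  (h^-1 * (f (x + h) - f x)) @[h --> within [set h | I (x + h)] 0^'].

Definition derivable_on (R : realType) (I : set R) (f : R -> R) (x : R) :=
  cvg (diff_quotient I f x).

Definition derive_on (R : realType) (I : set R) (f : R -> R) (x : R) : R :=
  lim (diff_quotient I f x).

Lemma diff_quotient_interior (R : realType) (I : set R) (f : R -> R) (x : R) :
  interior I x ->
  diff_quotient I f x = (h^-1 *: (f (h *: 1 + x) - f x)) @[h --> 0^'].
Proof.
move=> Ix; rewrite /diff_quotient.
have nI : \forall h \near 0^', I (x + h).
  apply: nbhs_dnbhs.
  have : (fun h : R => x + h) @ 0 --> x.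
    by rewrite -[X in _ --> X]addr0; apply: cvgD; [exact: cvg_cst|exact: cvg_id].
  by move/(_ _ Ix).
have -> : within [set h | I (x + h)] 0^' = 0^' :> set_system R.
  apply/seteqP; split=> A /=; rewrite /within /=.
    by move=> AI; apply: filterS2 nI AI => h Ih; apply.
  by move=> A0; apply: filterS A0 => h Ah _.
have -> // : (fun h : R => h^-1 * (f (x + h) - f x)) =
             (fun h => h^-1 *: (f (h *: (1 : R) + x) - f x)).
by apply/funext => h; rewrite /GRing.scale /= mulr1 [h + x]addrC.
Qed.

Lemma derivable_on_interior (R : realType) (I : set R) (f : R -> R) (x : R) :
  interior I x -> derivable_on I f x <-> derivable f x 1.
Proof. by move=> Ix; rewrite /derivable_on diff_quotient_interior. Qed.

Lemma derive_on_interior (R : realType) (I : set R) (f : R -> R) (x : R) :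
  interior I x -> derive_on I f x = 'D_1 f x.
Proof. by move=> Ix; rewrite /derive_on diff_quotient_interior. Qed.

Lemma diff_quotient_left_end (R : realType) (I : set R) (f : R -> R) (x y : R) :
  is_interval I -> I x -> (forall z, I z -> x <= z) -> I y -> x < y ->
  diff_quotient I f x = (h^-1 * (f (x + h) - f x)) @[h --> 0^'+].
Proof.
move=> itvI Ix xmin Iy xy; rewrite /diff_quotient.
have -> // : within [set h | I (x + h)] 0^' = 0^'+ :> set_system R.
rewrite /at_right /dnbhs; apply/seteqP; split=> A /=; rewrite /within /= => A0.
  have yx : \forall h \near (0 : R), h < y - x by apply: lt_nbhsl; rewrite subr_gt0.
  apply: filterS2 yx A0 => h hy Ah h0; apply: Ah; first by rewrite gt_eqF.
  by apply: (itvI x y) => //; rewrite lerDl ltW//= addrC -lerBrDr ltW.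
apply: filterS A0 => h Ah h0 /xmin; rewrite lerDl => hge0.
by apply: Ah; rewrite lt_neqAle eq_sym h0.
Qed.

Lemma diff_quotient_right_end (R : realType) (I : set R) (f : R -> R) (x y : R) :
  is_interval I -> I x -> (forall z, I z -> z <= x) -> I y -> y < x ->
  diff_quotient I f x = (h^-1 * (f (x + h) - f x)) @[h --> 0^'-].
Proof.
move=> itvI Ix xmax Iy yx; rewrite /diff_quotient.
have -> // : within [set h | I (x + h)] 0^' = 0^'- :> set_system R.
rewrite /at_left /dnbhs; apply/seteqP; split=> A /=; rewrite /within /= => A0.
  have hyx : \forall h \near (0 : R), y - x < h by apply: lt_nbhsr; rewrite subr_lt0.
  apply: filterS2 hyx A0 => h hy Ah h0; apply: Ah; first by rewrite lt_eqF.
  by apply: (itvI y x) => //; rewrite gerDl (ltW h0) andbT addrC -lerBlDr ltW.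
apply: filterS A0 => h Ah h0 /xmax; rewrite gerDl => hle0.
by apply: Ah; rewrite lt_neqAle h0.
Qed.

Definition strongly_convex_on (R : realType) (J : set R) (c : R) (h : R -> R) :=
  forall x y t : R, J x -> J y -> 0 < t < 1 ->
    h (t * x + (1 - t) * y)
      <= t * h x + (1 - t) * h y - c * t * (1 - t) * (x - y) ^+ 2.

(* Main.v *)
(* Strong convexity on a subinterval [p, q] gives, with both endpoint values
   bounded by M, |f'(u)| <= M - c (u - p) (q - u).  By monotonicity of G +- f,
   where G is a primitive of this bound, |f v - f u| <= G v - G u, and the
   integral of this over [p, q], with v = q or u = p fixed, is bounded by
   (q - p)^2 / 2 (M - c (q - p)^2 / 6).  Apply this to [a, x] and [x, b], since
   f x minus its mean is the mean of f x - f u. *)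

Require Import Defs.
From HB Require Import structures.
From mathcomp Require Import all_boot all_order all_algebra.
From mathcomp Require Import all_classical all_reals all_analysis.
From mathcomp Require Import ring lra.
Import Order.TTheory GRing.Theory Num.Theory.
Import numFieldNormedType.Exports.
Local Open Scope classical_set_scope.
Local Open Scope ring_scope.

(** Off [h = 0], [f (u + h)] equals [h] times the difference quotient plus [f u]; the product tends
    to [0 * l]. *)
Lemma derivable_on_cvg (R : realType) (I : set R) (f : R -> R) (u : R) :
  derivable_on I f u ->
  f (u + h) @[h --> within [set h | I (u + h)] 0^'] --> f u.
Proof.
move=> /cvg_ex[l fl].
have idh : h @[h --> within [set h | I (u + h)] 0^'] --> (0 : R).
  move=> A A0; have := nbhs_dnbhs A0.
  by apply: filterS => h Ah _; exact: Ah.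
have FF : Filter (within [set h | I (u + h)] 0^') by exact: within_filter.
have := @cvgD _ _ _ _ FF _ _ _ _
  (@cvgM _ _ _ FF _ _ _ _ idh fl) (@cvg_cst _ _ _ _ FF).
rewrite mul0r => /(_ (f u)); rewrite add0r => fu.
refine (cvg_trans _ fu); refine (near_eq_cvg _).
rewrite near_withinE; near=> h => _ /=.
have h0 : h != 0 by near: h; exact: nbhs_dnbhs_neq.
by rewrite !fctE /= mulVKf// subrK.
Unshelve. all: by end_near. Qed.

(** The substitution [h = y - u] carries the filter of increments to the points near [u], and [A]
    inside [I] makes every such increment admissible. *)
Lemma derivable_on_continuous (R : realType) (I A : set R) (f : R -> R) :
  A `<=` I -> (forall u, A u -> derivable_on I f u) ->
  {within A, continuous f}.
Proof.
move=> AI df; apply/subspace_continuousP => u Au.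
apply/cvgrPdist_lt => e e0.
have /cvgrPdist_lt/(_ _ e0) := derivable_on_cvg (df _ Au).
rewrite !near_withinE => fu.
have : y - u @[y --> u] --> (0 : R).
  by rewrite -(subrr u); apply: cvgB; [exact: cvg_id|exact: cvg_cst].
move=> /(_ _ fu) nu; apply: (@filterS _ (nbhs u) _ _ _ _ nu) => y /= yu Ay.
(* The punctured filter says nothing at [y = u], where the distance is zero. *)
have [->|yneu] := eqVneq y u; first by rewrite subrr normr0.
by have := yu _ _; rewrite subrKC; apply; [rewrite subr_eq0|exact: AI].
Qed.

(** Since [dG] dominates both [df] and [- df], the functions [G \+ f] and [G \- f] are
    nondecreasing; their two increments give the two sides of the absolute value. *)
Lemma ler_norm_derive (R : realType) (f G df dG : R -> R) (p q : R) :
  (forall u, u \in `]p, q[%R -> is_derive u 1 f (df u)) ->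
  (forall u, u \in `]p, q[%R -> is_derive u 1 G (dG u)) ->
  {within `[p, q], continuous f} -> {within `[p, q], continuous G} ->
  (forall u, u \in `]p, q[%R -> `|df u| <= dG u) ->
  forall u v, p <= u -> u <= v -> v <= q -> `|f v - f u| <= G v - G u.
Proof.
move=> Df DG cf cG dfG u v pu uv vq.
have DGDf w : w \in `]p, q[%R -> is_derive w 1 (G \+ f) (dG w + df w).
  by move=> wpq; have := Df _ wpq; have := DG _ wpq; exact: is_deriveD.
have DGBf w : w \in `]p, q[%R -> is_derive w 1 (G \- f) (dG w - df w).
  by move=> wpq; have := Df _ wpq; have := DG _ wpq; exact: is_deriveB.
have le_GDf : (G \+ f) u <= (G \+ f) v.
  apply: (@ger0_derive1_ndecr _ _ p q) => // w.
  - by move=> /DGDf/@ex_derive.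
  - move=> wpq; rewrite derive1E (@derive_val _ _ _ _ _ _ _ (DGDf _ wpq)).
    by have := dfG _ wpq; rewrite ler_norml => /andP[]; lra.
  - by apply: cvgD; [exact: cG|exact: cf].
have le_GBf : (G \- f) u <= (G \- f) v.
  apply: (@ger0_derive1_ndecr _ _ p q) => // w.
  - by move=> /DGBf/@ex_derive.
  - move=> wpq; rewrite derive1E (@derive_val _ _ _ _ _ _ _ (DGBf _ wpq)).
    by have := dfG _ wpq; rewrite ler_norml => /andP[]; lra.
  - by apply: cvgB; [exact: cG|exact: cf].
by move: le_GDf le_GBf; rewrite ler_norml /=; lra.
Qed.

(** This is the primitive vanishing at [p], read off from [(u - p) * (q - u) = (q - p) * (u - p) -
    (u - p) ^+ 2]. *)
Lemma is_derive_majorant (R : realType) (c M p q u : R) :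
  is_derive u 1
    (fun u : R =>
      M * (u - p) - c * ((q - p) * (u - p) ^+ 2 / 2 - (u - p) ^+ 3 / 3))
    (M - c * ((u - p) * (q - u))).
Proof.
apply: is_derive_eq.
by rewrite /GRing.scale /= !mulr0 !subr0; field.
Qed.

(** Integrating once more from [p] gives a function whose value at [q] is the final bound [(q - p)
    ^+ 2 / 2 * (M - c * (q - p) ^+ 2 / 6)]. *)
Lemma is_derive_majorant_primitive (R : realType) (c M p q u : R) :
  is_derive u 1
    (fun u : R =>
      M * (u - p) ^+ 2 / 2
      - c * ((q - p) * (u - p) ^+ 3 / 6 - (u - p) ^+ 4 / 12))
    (M * (u - p) - c * ((q - p) * (u - p) ^+ 2 / 2 - (u - p) ^+ 3 / 3)).
Proof.
apply: is_derive_eq.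
by rewrite /GRing.scale /= !mulr0 !subr0; field.
Qed.

Lemma norm_Rintegral_le_primitive (R : realType) (g B Q : R -> R) (p q : R) :
  p < q -> {within `[p, q], continuous g} -> continuous B ->
  (forall u : R, is_derive u 1 Q (B u)) ->
  (forall u, u \in `[p, q]%R -> `|g u| <= B u) ->
  `|\int[@lebesgue_measure R]_(u in `[p, q]) g u| <= Q q - Q p.
Proof.
move=> pq cg cB DQ gB.
have cB' : {within `[p, q], continuous B} by exact: continuous_subspaceT.
have cQ u : {for u, continuous Q}.
  apply: differentiable_continuous; apply/derivable1_diffP.
  by have /@ex_derive := DQ u.
have ic h : {within `[p, q], continuous h} ->
    (@lebesgue_measure R).-integrable `[p, q] (EFin \o h).
  move=> ch; apply: continuous_compact_integrable => //.
  exact: segment_compact.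
(* The fundamental theorem of calculus turns the increment of [Q] into the integral of [B], so that
   only integrals remain to be compared. *)
have <- : \int[@lebesgue_measure R]_(u in `[p, q]) B u = Q q - Q p.
  rewrite /Rintegral (@continuous_FTC2 _ B Q)//.
    split.
    - by move=> u _; have /@ex_derive := DQ u.
    - by apply: cvg_at_right_filter; exact: cQ.
    - by apply: cvg_at_left_filter; exact: cQ.
  by move=> u _; rewrite derive1E; have /@derive_val := DQ u.
apply: le_trans (le_normr_Rintegral _ _) _ => //; first exact: ic.
apply: le_Rintegral => //; last exact: ic.
by apply: ic => u; apply: cvg_norm; exact: cg.
Qed.

Lemma norm_Rintegral_sub_le (R : realType) (f df : R -> R) (c M p q z : R) :
  p <= q -> z = p \/ z = q -> {within `[p, q], continuous f} ->
  (forall u, u \in `]p, q[%R -> is_derive u 1 f (df u)) ->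
  (forall u, u \in `]p, q[%R -> `|df u| <= M - c * ((u - p) * (q - u))) ->
  `|\int[@lebesgue_measure R]_(u in `[p, q]) (f z - f u)|
    <= (q - p) ^+ 2 / 2 * (M - c * (q - p) ^+ 2 / 6).
Proof.
(* The degenerate segment, met when [x] is [a] or [b], makes both sides zero. *)
rewrite le_eqVlt => /predU1P[<-|pq] zpq cf Df dfM.
  by rewrite set_itv1 Rintegral_set1 normr0 subrr expr0n /= !mul0r.
have DG (u : R) := is_derive_majorant c M p q u.
have DP (u : R) := is_derive_majorant_primitive c M p q u.
set G := fun u => _ in DG; set P := fun u => _ in DP.
have cG : continuous G.
  move=> u; apply: differentiable_continuous; apply/derivable1_diffP.
  by have /@ex_derive := DG u.
have fG := @ler_norm_derive _ f G df _ p q Df (fun u _ => DG u) cf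
  (@continuous_subspaceT _ _ _ _ cG) dfM.
have cg : {within `[p, q], continuous (fun u => f z - f u)}.
  by move=> u; apply: cvgB; [exact: cvg_cst|exact: cf].
case: zpq => zE.
  (* For [z = p] the majorant is [G u - G p = G u], because [G] vanishes at [p]; its primitive is
     [P]. *)
  have -> : (q - p) ^+ 2 / 2 * (M - c * (q - p) ^+ 2 / 6) = P q - P p.
    by rewrite /P; field.
  apply: (@norm_Rintegral_le_primitive _ _ G) => //.
  move=> u; rewrite in_itv/= => /andP[pu uq].
  have := fG p u (lexx _) pu uq; rewrite zE distrC => /le_trans; apply.
  by rewrite {2}/G subrr; lra.
(* For [z = q] the majorant is [G q - G u], with primitive [Q]; by symmetry of the weight
   [(u - p) * (q - u)] the increment is the same. *)
pose Q (u : R) : R := G q * u - P u.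
have -> : (q - p) ^+ 2 / 2 * (M - c * (q - p) ^+ 2 / 6) = Q q - Q p.
  by rewrite /Q /P /G; field.
apply: (@norm_Rintegral_le_primitive _ _ (fun u => G q - G u)) => //.
- by move=> u; apply: cvgB; [exact: cvg_cst|exact: cG].
- move=> u; have DPu := DP u.
  by rewrite /Q; apply: is_derive_eq; rewrite /GRing.scale /= mulr1.
- by move=> u; rewrite in_itv/= => /andP[pu uq]; rewrite zE; exact: fG.
Qed.

Theorem theorem1 (R : realType) (I : set R) (a b : R) (f : R -> R) (c M x : R)
  (itvI : is_interval I) (aI : I a) (bI : I b) (ltab : a < b)
  (df_int : forall u, interior I u -> derivable f u 1)
  (df_ab : forall u, u \in `[a, b] -> derivable_on I f u)
  (intf' : (@lebesgue_measure R).-integrable `[a, b] (EFin \o derive_on I f))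
  (c_gt0 : 0 < c)
  (scf' : strongly_convex_on `[a, b] c (fun u => `|derive_on I f u|))
  (leM : forall u, u \in `[a, b] -> `|derive_on I f u| <= M)
  (xab : x \in `[a, b])
  (geM : Num.max (c * (x - a) ^+ 2 / 6) (c * (b - x) ^+ 2 / 6) <= M) :
  `|f x - (b - a)^-1 * \int[@lebesgue_measure R]_(u in `[a, b]) f u|
    <= (x - a) ^+ 2 / (2 * (b - a)) * (M - c * (x - a) ^+ 2 / 6)
     + (b - x) ^+ 2 / (2 * (b - a)) * (M - c * (b - x) ^+ 2 / 6).
Proof.
move: (xab); rewrite in_itv/= => /andP[ax xb].
have abI : `[a, b] `<=` I by move=> u /=; rewrite in_itv/=; exact: itvI aI bI _.
have cf : {within `[a, b], continuous f}.
  by apply: derivable_on_continuous abI df_ab.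
have Df u : u \in `]a, b[%R -> is_derive u 1 f (derive_on I f u).
  (* The open interval lies in [I], so its points are interior to [I], where [derive_on] is the
     ordinary derivative. *)
  move=> uab; have Iu : interior I u.
    apply: (@interiorS _ `]a, b[).
      by apply: subset_trans abI; exact: subset_itvW.
    by rewrite (interior_id _).1//=.
  by rewrite derive_on_interior//; apply/derivableP; exact: df_int.
(* Both choices of [z] are needed: [x] is the right end of [[a, x]] and the left end of [[x, b]]. *)
have seg p q z : a <= p -> p <= q -> q <= b -> z = p \/ z = q ->
    `|\int[@lebesgue_measure R]_(u in `[p, q]) (f z - f u)|
      <= (q - p) ^+ 2 / 2 * (M - c * (q - p) ^+ 2 / 6).
  move=> ap pq qb zpq.
  have cpq : {within `[p, q], continuous f}.
    by apply: continuous_subspaceW cf; apply: subset_itvScc; rewrite bnd_simp.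
  have Dpq u : u \in `]p, q[%R -> is_derive u 1 f (derive_on I f u).
    by move=> upq; apply: Df; apply: subset_itv upq; rewrite bnd_simp.
  suff dfpq u : u \in `]p, q[%R ->
      `|derive_on I f u| <= M - c * ((u - p) * (q - u)).
    exact: norm_Rintegral_sub_le pq zpq cpq Dpq dfpq.
  rewrite in_itv/= => /andP[pu uq].
  have pltq := lt_trans pu uq.
  have qp0 : q - p != 0 by rewrite subr_eq0 gt_eqF.
  (* The weight with [u = t * q + (1 - t) * p]; it gives [t * (1 - t) * (q - p) ^+ 2 = (u - p) * (q
     - u)]. *)
  pose t := (u - p) / (q - p).
  have t01 : 0 < t < 1.
    by rewrite divr_gt0 ?subr_gt0//= ltr_pdivrMr ?subr_gt0// mul1r ltrD2r.
  have abp : p \in `[a, b]%R by rewrite in_itv/= ap (le_trans pq).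
  have abq : q \in `[a, b]%R by rewrite in_itv/= qb (le_trans ap).
  have /= := scf' q p t abq abp t01.
  have -> : t * q + (1 - t) * p = u by rewrite /t; field.
  have -> : c * t * (1 - t) * (q - p) ^+ 2 = c * ((u - p) * (q - u)).
    by rewrite /t; field.
  have Mp : `|derive_on I f p| <= M by exact: leM.
  have Mq : `|derive_on I f q| <= M by exact: leM.
  (* The convex combination of the two endpoint values is at most [M]. *)
  by case/andP: t01 => t0 t1; nra.
have ic p q z : a <= p -> q <= b ->
    (@lebesgue_measure R).-integrable `[p, q] (EFin \o (fun u => f z - f u)).
  move=> ap qb.
  apply: continuous_compact_integrable; first exact: segment_compact.
  have cpq : {within `[p, q], continuous f}.
    by apply: continuous_subspaceW cf; apply: subset_itvScc; rewrite bnd_simp.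
  by move=> u; apply: cvgB; [exact: cvg_cst|exact: cpq].
have ba0 : 0 < b - a by rewrite subr_gt0.
(* The constant [f x] is its own mean over [[a, b]], and the integral of the difference is cut at
   [x]. *)
have split : f x - (b - a)^-1 * \int[@lebesgue_measure R]_(u in `[a, b]) f u =
    (b - a)^-1 * (\int[@lebesgue_measure R]_(u in `[a, x]) (f x - f u) +
                  \int[@lebesgue_measure R]_(u in `[x, b]) (f x - f u)).
  (* Removing the point [x] from [[x, b]] leaves the integral unchanged and makes the two pieces
     disjoint, so that they add up to the integral over [[a, b]]. *)
  rewrite -(@Rintegral_itv_obnd_cbnd _ x (BRight b)); last first.
    apply: integrableS (ic x b x ax (lexx _)) => //.
    by apply: subset_itvScc; rewrite bnd_simp.
  rewrite -(@Rintegral_itvB _ _ (BLeft a) (BRight b) x)//; last exact: ic.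
  rewrite subrKC RintegralB//; last first.
  - by apply: continuous_compact_integrable => //; exact: segment_compact.
  - apply: continuous_compact_integrable; first exact: segment_compact.
    by move=> u; exact: cvg_cst.
  rewrite Rintegral_cst//= lebesgue_measure_itv/= lte_fin ltab/=.
  by field; rewrite gt_eqF.
rewrite split normrM gtr0_norm ?invr_gt0//.
have -> : (x - a) ^+ 2 / (2 * (b - a)) * (M - c * (x - a) ^+ 2 / 6)
     + (b - x) ^+ 2 / (2 * (b - a)) * (M - c * (b - x) ^+ 2 / 6) =
  (b - a)^-1 * ((x - a) ^+ 2 / 2 * (M - c * (x - a) ^+ 2 / 6)
     + (b - x) ^+ 2 / 2 * (M - c * (b - x) ^+ 2 / 6)).
  by field; rewrite gt_eqF.
rewrite ler_pM2l ?invr_gt0//; apply: le_trans (ler_normD _ _) _.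
by apply: lerD; apply: seg => //; [right|left].
Qed.
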